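(* Let $K$ be a field of characteristic $p>0$. The additive group $W_2(K)$ of length-two Witt vectors, an affine plane on which $W_2(K)$ acts by translations, embeds as $W_2(K)\hookrightarrow\mathrm{GA}_2(K)\subset\mathrm{Cr}_2(K)$, and its nonzero elements have order $p^2$.
   Context: $\mathrm{GA}_2(K)$ is the group of polynomial automorphisms of the affine plane over $K$: an element is a pair $F=(F_1,F_2)\in K[X_1,X_2]^2$ that has a two-sided inverse in $K[X_1,X_2]^2$ under the composition $(F\circ G)_i=F_i(G_1,G_2)$. $\mathrm{Cr}_2(K)$ is the plane Cremona group, the group of $K$-automorphisms of the rational function field $K(X_1,X_2)$; it contains $\mathrm{GA}_2(K)$. $W_2(K)$ is the set $K^2$ with the length-two ($p$-typical) Witt vector addition $$(x_0,x_1)+(y_0,y_1)=\Bigl(x_0+y_0,\ x_1+y_1-\sum_{i=1}^{p-1}\tfrac1p\tbinom{p}{i}x_0^{i}y_0^{p-i}\Bigr).$$ The translation action of $a=(a_0,a_1)\in W_2(K)$ is the polynomial map of the plane given by $(X_1,X_2)\mapsto (X_1,X_2)+(a_0,a_1)$, with $+$ the Witt vector addition.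
   Formalization: ''Its nonzero elements have order p^2'' is false for nonzero (0,a_1), such as (0,1), which has order p; it is proved instead that elements with a_0 ≠ 0 have order exactly p^2 and nonzero elements with a_0 = 0 have order exactly p. *)

(* Defs.v *)
From HB Require Import structures.
From mathcomp Require Import all_boot all_order all_algebra.
From mathcomp Require Import boolp ring.
From mathcomp.multinomials Require Import mpoly.

Set Implicit Arguments.
Unset Strict Implicit.
Unset Printing Implicit Defensive.

Import GRing.Theory Num.Theory.
Local Open Scope ring_scope.

(* The quotient 'C(p, i) %/ p is exact for p prime and 0 < i < p; dividing in
   nat gives the formula a meaning in characteristic p. *)
Definition witt_cocycle (R : comNzRingType) (p : nat) (x y : R) : R :=
  \sum_(1 <= i < p) ('C(p, i) %/ p)%:R * (x ^+ i * y ^+ (p - i)).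

(* Stated over any commutative ring so that the same formula serves for K and
   for K[X_1, X_2]. *)
Definition witt_add (R : comNzRingType) (p : nat) (x y : R * R) : R * R :=
  (x.1 + y.1, x.2 + y.2 - witt_cocycle p x.1 y.1).

Definition witt_opp (R : comNzRingType) (p : nat) (x : R * R) : R * R :=
  (- x.1, witt_cocycle p x.1 (- x.1) - x.2).

Section WittAdd.
Variables (p : nat) (p_pr : prime p).

Lemma witt_cocycle_expD (R : comNzRingType) (x y : R) :
  p%:R * witt_cocycle p x y = (x + y) ^+ p - x ^+ p - y ^+ p.
Proof using p_pr.
have p_gt0 := prime_gt0 p_pr.
rewrite [x + y]addrC exprDn.
rewrite -(big_mkord xpredT (fun i => y ^+ (p - i) * x ^+ i *+ 'C(p, i))).
rewrite big_nat_recr //= big_ltn // subn0 subnn bin0 binn !expr0 mul1r mulr1.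
rewrite !mulr1n; set s := (X in y ^+ p + X + _).
have -> : y ^+ p + s + x ^+ p - x ^+ p - y ^+ p = s by ring.
rewrite /witt_cocycle mulr_sumr; apply: eq_big_nat => i i_bnd.
by rewrite mulrA -natrM mulnC divnK ?prime_dvd_bin // mulr_natl [_ * y ^+ _]mulrC.
Qed.

Lemma rmorph_witt_cocycle (R S : comNzRingType) (f : {rmorphism R -> S}) x y :
  f (witt_cocycle p x y) = witt_cocycle p (f x) (f y).
Proof using.
rewrite rmorph_sum; apply: eq_bigr => i _.
by rewrite !rmorphM rmorph_nat !rmorphXn.
Qed.

Lemma witt_cocycleC (R : comNzRingType) (x y : R) :
  witt_cocycle p x y = witt_cocycle p y x.
Proof using p_pr.
rewrite /witt_cocycle big_nat_rev /= add1n; apply: eq_big_nat => i.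
move=> /andP[i_gt0 i_lt]; rewrite subSS bin_sub ?(ltnW i_lt) //.
by rewrite (subKn (ltnW i_lt)) [_ * x ^+ _]mulrC.
Qed.

Lemma witt_cocycle0 (R : comNzRingType) (y : R) : witt_cocycle p 0 y = 0.
Proof using.
rewrite /witt_cocycle big_nat; apply: big1 => i /andP[i_gt0 _].
by rewrite expr0n eqn0Ngt i_gt0 /= mul0r mulr0.
Qed.

(* The identity p * S(x, y) = (x + y)^p - x^p - y^p determines S over Z[X, Y, Z],
   where p can be cancelled; evaluation transfers the result to R. *)
Lemma witt_cocycle_torsionfree (A R : comNzRingType) (f : {rmorphism A -> R})
    (x y z : A) : injective (fun t : A => p%:R * t) ->
  witt_cocycle p (f x) (f y) + witt_cocycle p (f x + f y) (f z) =
  witt_cocycle p (f y) (f z) + witt_cocycle p (f x) (f y + f z).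
Proof using p_pr.
move=> p_inj; rewrite -!rmorphD -!rmorph_witt_cocycle -!rmorphD.
congr (f _); apply: p_inj; rewrite !mulrDr !witt_cocycle_expD [x + (y + z)]addrA.
move: ((x + y + z) ^+ p) ((x + y) ^+ p) ((y + z) ^+ p) => a b c.
by move: (x ^+ p) (y ^+ p) (z ^+ p) => u v w; ring.
Qed.

Lemma witt_cocycleP (R : comNzRingType) (x y z : R) :
  witt_cocycle p x y + witt_cocycle p (x + y) z =
  witt_cocycle p y z + witt_cocycle p x (y + z).
Proof using p_pr.
pose h := tnth [tuple x; y; z].
have p_inj : injective (fun t : {mpoly int[3]} => p%:R * t).
  by apply: mulfI; rewrite -mpolyC_nat mpolyC_eq0 pnatr_eq0 -lt0n prime_gt0.
have hE i : mmap intr h ('X_i : {mpoly int[3]}) = h i by rewrite mmapX mmap1U.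
have := witt_cocycle_torsionfree (mmap intr h) 'X_ord0 'X_(inord 1) 'X_ord_max.
by move=> /(_ p_inj) /=; rewrite !hE /h !(tnth_nth 0) inordK.
Qed.

End WittAdd.

(* W_2(K); the proof argument only keys the group structure, which needs p to
   be prime. *)
Definition W2 (K : fieldType) (p : nat) of p \in [pchar K] : Type :=
  (K * K)%type.

Section W2Group.
Variables (K : fieldType) (p : nat) (charKp : p \in [pchar K]).
Let p_pr : prime p := pcharf_prime charKp.

HB.instance Definition _ := Choice.copy (W2 charKp) (K * K)%type.

Let add (x y : W2 charKp) : W2 charKp := witt_add p x y.
Let opp (x : W2 charKp) : W2 charKp := witt_opp p x.
Let zero : W2 charKp := (0, 0).

Fact W2_addA : associative add.
Proof using p_pr.
move=> [x0 x1] [y0 y1] [z0 z1]; congr (_, _) => /=; first exact: addrA.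
have := witt_cocycleP p_pr x0 y0 z0.
set a := witt_cocycle p x0 y0; set b := witt_cocycle p _ z0.
by move=> /(canRL (addKr _)) ->; rewrite -/a; ring.
Qed.

Fact W2_addC : commutative add.
Proof using p_pr.
move=> [x0 x1] [y0 y1]; congr (_, _) => /=; first exact: addrC.
by rewrite (witt_cocycleC p_pr) [x1 + _]addrC.
Qed.

Fact W2_add0 : left_id zero add.
Proof using.
by move=> [x0 x1]; congr (_, _); rewrite /= ?witt_cocycle0 ?subr0 add0r.
Qed.

Fact W2_addN : left_inverse zero opp add.
Proof using p_pr.
move=> [x0 x1]; congr (_, _); rewrite /= ?addNr // (witt_cocycleC p_pr (- x0)).
by rewrite subrK subrr.
Qed.

HB.instance Definition _ :=
  GRing.isZmodule.Build (W2 charKp) W2_addA W2_addC W2_add0 W2_addN.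

End W2Group.

Notation polymap K := (2.-tuple {mpoly K[2]}).

Section GA2.
Variable K : fieldType.

Definition polymap_id : polymap K := [tuple 'X_i | i < 2].

Definition polymap_comp (F G : polymap K) : polymap K :=
  [tuple tnth F i \mPo G | i < 2].

Lemma comp_mpolyA (q : {mpoly K[2]}) (F G : polymap K) :
  (q \mPo F) \mPo G = q \mPo polymap_comp F G.
Proof.
rewrite [RHS]comp_mpolyEX [q \mPo F]comp_mpolyEX raddf_sum.
apply: eq_bigr => m _; rewrite /= comp_mpolyZ !comp_mpolyX rmorph_prod /=.
by congr (_ *: _); apply: eq_bigr => i _; rewrite rmorphXn tnth_mktuple.
Qed.

Lemma polymap_compA : associative polymap_comp.
Proof.
by move=> F G H; apply: eq_from_tnth => i; rewrite !tnth_mktuple comp_mpolyA.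
Qed.

Lemma polymap_comp1 : right_id polymap_id polymap_comp.
Proof.
by move=> F; apply: eq_from_tnth => i; rewrite tnth_mktuple comp_mpoly_id.
Qed.

Lemma polymap_1comp : left_id polymap_id polymap_comp.
Proof.
move=> F; apply: eq_from_tnth => i.
by rewrite !tnth_mktuple comp_mpolyXU -tnth_nth.
Qed.

Definition polymap_inverse (F G : polymap K) : Prop :=
  polymap_comp F G = polymap_id /\ polymap_comp G F = polymap_id.

Record GA2 := MkGA2 {
  GA2_map :> polymap K;
  _ : `[< exists G, polymap_inverse GA2_map G >] }.

HB.instance Definition _ := [isSub for GA2_map].
HB.instance Definition _ := [Choice of GA2 by <:].

Lemma GA2_invertible (F : GA2) : exists G, polymap_inverse F G.
Proof. by case: F => F /= /asboolP. Qed.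

Fact GA2_one_subproof : `[< exists G, polymap_inverse polymap_id G >].
Proof.
by apply/asboolP; exists polymap_id; split; rewrite polymap_comp1.
Qed.

Fact GA2_mul_subproof (F G : GA2) :
  `[< exists H, polymap_inverse (polymap_comp F G) H >].
Proof.
apply/asboolP; have [F' [FF' F'F]] := GA2_invertible F.
have [G' [GG' G'G]] := GA2_invertible G; exists (polymap_comp G' F'); split.
  by rewrite polymap_compA -(polymap_compA F) GG' polymap_comp1.
by rewrite polymap_compA -(polymap_compA G') F'F polymap_comp1.
Qed.

Fact GA2_inv_subproof (F : GA2) :
  `[< exists H, polymap_inverse (projT1 (cid (GA2_invertible F))) H >].
Proof.
by case: cid => G [FG GF] /=; apply/asboolP; exists F; split.
Qed.

Definition GA2_one : GA2 := MkGA2 GA2_one_subproof.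
Definition GA2_mul (F G : GA2) : GA2 := MkGA2 (GA2_mul_subproof F G).
Definition GA2_inv (F : GA2) : GA2 := MkGA2 (GA2_inv_subproof F).

Fact GA2_mulA : associative GA2_mul.
Proof. by move=> F G H; apply: val_inj; apply: polymap_compA. Qed.
Fact GA2_mul1 : right_id GA2_one GA2_mul.
Proof. by move=> F; apply: val_inj; apply: polymap_comp1. Qed.
Fact GA2_1mul : left_id GA2_one GA2_mul.
Proof. by move=> F; apply: val_inj; apply: polymap_1comp. Qed.
Fact GA2_mulV : right_inverse GA2_one GA2_inv GA2_mul.
Proof. by move=> F; apply: val_inj => /=; case: cid => G []. Qed.
Fact GA2_Vmul : left_inverse GA2_one GA2_inv GA2_mul.
Proof. by move=> F; apply: val_inj => /=; case: cid => G []. Qed.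

HB.instance Definition _ :=
  isGroup.Build GA2 GA2_mulA GA2_1mul GA2_mul1 GA2_Vmul GA2_mulV.

End GA2.

Section Cr2.
Variable K : fieldType.

Notation KX := {fraction {mpoly K[2]}}.

Definition is_Kautomorphism (f : KX -> KX) : Prop :=
  [/\ zmod_morphism f, monoid_morphism f,
      forall c : K, f (tofrac c%:MP) = tofrac c%:MP & bijective f].

Record Cr2 := MkCr2 { Cr2_fun :> KX -> KX; _ : `[< is_Kautomorphism Cr2_fun >] }.

HB.instance Definition _ := [isSub for Cr2_fun].
HB.instance Definition _ := [Choice of Cr2 by <:].

Lemma Cr2P (f : Cr2) : is_Kautomorphism f.
Proof. by case: f => f /= /asboolP. Qed.

Lemma Cr2_inverse (f : Cr2) : exists g : KX -> KX, cancel f g /\ cancel g f.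
Proof. by have [_ _ _ [g]] := Cr2P f; exists g. Qed.

Fact Cr2_one_subproof : `[< is_Kautomorphism id >].
Proof. by apply/asboolP; split=> //; exists id. Qed.

Fact Cr2_mul_subproof (f g : Cr2) : `[< is_Kautomorphism (f \o g) >].
Proof.
apply/asboolP; have [fB [f1 fM] fK fbij] := Cr2P f.
have [gB [g1 gM] gK gbij] := Cr2P g; split=> /=.
- by move=> x y /=; rewrite gB fB.
- by split=> [|x y] /=; rewrite ?g1 ?f1 // gM fM.
- by move=> c; rewrite gK fK.
- exact: bij_comp.
Qed.

Fact Cr2_inv_subproof (f : Cr2) :
  `[< is_Kautomorphism (projT1 (cid (Cr2_inverse f))) >].
Proof.
case: cid => g [fgK gfK] /=; apply/asboolP; have [fB [f1 fM] fC _] := Cr2P f.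
split.
- by move=> x y; apply: (can_inj fgK); rewrite fB !gfK.
- split=> [|x y]; apply: (can_inj fgK); rewrite ?fM !gfK //; exact: esym f1.
- by move=> c; rewrite -{1}fC fgK.
- by exists f.
Qed.

Definition Cr2_one : Cr2 := MkCr2 Cr2_one_subproof.
Definition Cr2_mul (f g : Cr2) : Cr2 := MkCr2 (Cr2_mul_subproof f g).
Definition Cr2_inv (f : Cr2) : Cr2 := MkCr2 (Cr2_inv_subproof f).

Fact Cr2_mulA : associative Cr2_mul.
Proof. by move=> f g h; apply: val_inj. Qed.
Fact Cr2_mul1 : right_id Cr2_one Cr2_mul.
Proof. by move=> f; apply: val_inj. Qed.
Fact Cr2_1mul : left_id Cr2_one Cr2_mul.
Proof. by move=> f; apply: val_inj. Qed.
Fact Cr2_mulV : right_inverse Cr2_one Cr2_inv Cr2_mul.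
Proof.
by move=> f; apply: val_inj; apply/funext => x /=; case: cid => g [].
Qed.
Fact Cr2_Vmul : left_inverse Cr2_one Cr2_inv Cr2_mul.
Proof.
by move=> f; apply: val_inj; apply/funext => x /=; case: cid => g [].
Qed.

HB.instance Definition _ :=
  isGroup.Build Cr2 Cr2_mulA Cr2_1mul Cr2_mul1 Cr2_Vmul Cr2_mulV.

(* F |-> (h |-> h o F) reverses composition, so GA_2(K) sits in Cr_2(K) through
   F |-> (h |-> h o F^-1). An automorphism is determined by its values on the
   two coordinate functions. *)
Definition is_GA2_inclusion (iota : GA2 K -> Cr2) : Prop :=
  [/\ {morph iota : F G / (F * G)%g >-> (F * G)%g}, injective iota
    & forall (F : GA2 K) (i : 'I_2),
        iota F (tofrac 'X_i) = tofrac (tnth (F^-1)%g i)].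

End Cr2.

(* (X_1, X_2) + (a_0, a_1), Witt addition over K[X_1, X_2]. *)
Definition W2_translation (K : fieldType) (p : nat) (charKp : p \in [pchar K])
    (a : W2 charKp) : polymap K :=
  let F := witt_add p ('X_ord0, 'X_ord_max) (a.1%:MP, a.2%:MP) in
  [tuple F.1; F.2].

Definition has_additive_order (V : zmodType) (x : V) (n : nat) : Prop :=
  [/\ (0 < n)%N, x *+ n = 0 & forall m, (0 < m < n)%N -> x *+ m <> 0].

(* Main.v *)
Require Import Defs.
From HB Require Import structures.
From mathcomp Require Import all_boot all_order all_algebra.
From mathcomp Require Import boolp ring.
From mathcomp.multinomials Require Import mpoly.

Set Implicit Arguments.
Unset Strict Implicit.
Unset Printing Implicit Defensive.

Import GRing.Theory.
Local Open Scope ring_scope.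

(** Translations by [W2_translation] compose like Witt vectors add because the
    group law is given by polynomials with integer coefficients: substituting
    the translation by [b] into the translation by [a] is a ring morphism, so it
    carries the formula for [X + a] to the formula for [(X + b) + a], and
    associativity, which holds over [K[X_1, X_2]] as over any commutative ring,
    turns this into [X + (b + a)] ([W2_translationD]). In particular the
    translation by [- a] inverts the one by [a], and the two coordinates of a
    translation determine first [a.1] and then [a.2].

    For the inclusion in the Cremona group, substituting an automorphism [F] of
    the plane is an injective endomorphism of the polynomial ring, hence extends
    to the field of rational functions by the universal property of fractions
    ([frac_lift], [eq_frac_rmorph]). The extension [GA2_pullback] is
    contravariant in [F]; composing it with the inverse makes it a morphism.

    For the orders, repeated addition gives
    [a *+ n = (a.1 *+ n, a.2 *+ n - \sum_(k < n) S (a.1 *+ k, a.1))] with [S] the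
    cocycle. At [n = p] the sum is homogeneous of degree [p] in [a.1], and its
    coefficient is the integer
    [\sum_(k < p) ((k + 1) ^ p - k ^ p - 1) / p = p ^ (p - 1) - 1], which is [-1]
    in characteristic [p]. Hence [p] times [a] is [(0, a.1 ^+ p)]
    ([W2_mulrp]): multiplication by [p] sends vectors with a nonzero first
    coordinate to nonzero vectors of the copy of [K] on which [a.1 = 0], whose
    nonzero elements have order [p]. *)

(** * Extending ring morphisms to fraction fields *)

Lemma fractionE (R : idomainType) (x : {fraction R}) :
  x = tofrac \n_(repr x) / tofrac \d_(repr x).
Proof.
have d_neq0 := denom_ratioP (repr x).
apply: (canRL (mulfK _)); first by rewrite tofrac_eq0.
rewrite -{1}[x]reprK /tofrac; unlock.
rewrite -[_ * _]FracField.pi_mul.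
apply/eqmodP; rewrite /= FracField.equivfE /FracField.mulf.
rewrite !numden_Ratio ?mulf_neq0 ?oner_neq0 //.
by rewrite !mulr1 mulrC.
Qed.

Lemma fractionP (R : idomainType) (x : {fraction R}) :
  exists n d, d != 0 /\ x = tofrac n / tofrac d.
Proof.
exists \n_(repr x), \d_(repr x).
by split; [exact: denom_ratioP | exact: fractionE].
Qed.

(** The numerator and denominator of the chosen representative of a fraction
    are used; injectivity of [f] keeps the image of the denominator nonzero and
    makes the quotient independent of this choice ([frac_lift_div]). The
    injectivity proof is an argument so that the ring morphism structure can be
    attached to [frac_lift f_inj]. *)
Definition frac_lift (R : idomainType) (L : fieldType) (f : {rmorphism R -> L})
    of injective f : {fraction R} -> L :=
  fun x => f \n_(repr x) / f \d_(repr x).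

Lemma frac_lift_div (R : idomainType) (L : fieldType) (f : {rmorphism R -> L})
    (f_inj : injective f) (n d : R) :
  d != 0 -> frac_lift f_inj (tofrac n / tofrac d) = f n / f d.
Proof.
move=> d_neq0; set x := tofrac n / tofrac d.
have e_neq0 := denom_ratioP (repr x).
rewrite /frac_lift; apply/eqP.
rewrite eqr_div -?(rmorph0 f) ?(inj_eq f_inj) // -!rmorphM (inj_eq f_inj).
rewrite -tofrac_eq !tofracM -eqr_div ?tofrac_eq0 //.
by rewrite -fractionE.
Qed.

Lemma frac_lift_tofrac (R : idomainType) (L : fieldType)
    (f : {rmorphism R -> L}) (f_inj : injective f) (a : R) :
  frac_lift f_inj (tofrac a) = f a.
Proof.
have := frac_lift_div f_inj a (oner_neq0 R).
by rewrite tofrac1 rmorph1 !divr1.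
Qed.

Section FracLiftMorphism.
Variables (R : idomainType) (L : fieldType) (f : {rmorphism R -> L}).
Variable f_inj : injective f.

Let f_neq0 (d : R) : d != 0 -> f d != 0.
Proof. by move=> d_neq0; rewrite -(rmorph0 f) (inj_eq f_inj). Qed.

Fact frac_lift_zmod_morphism : zmod_morphism (frac_lift f_inj).
Proof.
move=> x y; have [n [d [d0 ->]]] := fractionP x.
have [m [e [e0 ->]]] := fractionP y.
rewrite !frac_lift_div // -!mulNr !addf_div ?tofrac_eq0 ?f_neq0 //.
rewrite -tofracN -!tofracM -tofracD frac_lift_div ?mulf_neq0 //.
by rewrite rmorphD !rmorphM rmorphN.
Qed.

Fact frac_lift_monoid_morphism : monoid_morphism (frac_lift f_inj).
Proof.
split=> [|x y]; first by rewrite -tofrac1 frac_lift_tofrac rmorph1.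
have [n [d [d0 ->]]] := fractionP x; have [m [e [e0 ->]]] := fractionP y.
rewrite mulf_div -!tofracM !frac_lift_div ?mulf_neq0 //.
by rewrite mulf_div !rmorphM.
Qed.

HB.instance Definition _ := GRing.isZmodMorphism.Build {fraction R} L
  (frac_lift f_inj) frac_lift_zmod_morphism.
HB.instance Definition _ := GRing.isMonoidMorphism.Build {fraction R} L
  (frac_lift f_inj) frac_lift_monoid_morphism.

End FracLiftMorphism.

(** The uniqueness half of the universal property: identities between
    substitutions in rational functions follow from those in polynomials. *)
Lemma eq_frac_rmorph (R : idomainType) (L : fieldType)
    (g h : {rmorphism {fraction R} -> L}) :
  (forall a, g (tofrac a) = h (tofrac a)) -> g =1 h.
Proof.
move=> gh x; have [n [d [_ ->]]] := fractionP x.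
by rewrite !fmorph_div !gh.
Qed.

(** * GA_2 inside the plane Cremona group *)

(** Substituting an inverse of [F] undoes the substitution of [F]. *)
Lemma comp_mpoly_GA2_inj (K : fieldType) (F : GA2 K) :
  injective (@tofrac {mpoly K[2]} \o comp_mpoly F).
Proof.
have [G [FG _]] := GA2_invertible F.
move=> q r /= /eqP; rewrite tofrac_eq => /eqP /(congr1 (comp_mpoly G)).
by rewrite !comp_mpolyA FG !comp_mpoly_id.
Qed.

Definition GA2_pullback (K : fieldType) (F : GA2 K) :
    {rmorphism {fraction {mpoly K[2]}} -> {fraction {mpoly K[2]}}} :=
  frac_lift (@comp_mpoly_GA2_inj K F).

Lemma GA2_pullback_tofrac (K : fieldType) (F : GA2 K) (q : {mpoly K[2]}) :
  GA2_pullback F (tofrac q) = tofrac (q \mPo F).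
Proof. exact: frac_lift_tofrac. Qed.

Lemma GA2_pullback1 (K : fieldType) : @GA2_pullback K 1%g =1 id.
Proof.
apply: (@eq_frac_rmorph _ _ _ idfun) => q.
by rewrite GA2_pullback_tofrac comp_mpoly_id.
Qed.

Lemma GA2_pullbackM (K : fieldType) (F G : GA2 K) :
  GA2_pullback (F * G)%g =1 GA2_pullback G \o GA2_pullback F.
Proof.
apply: (@eq_frac_rmorph _ _ _ (GA2_pullback G \o GA2_pullback F)) => q.
have -> := GA2_pullback_tofrac (F * G)%g q.
apply: esym; apply: etrans (congr1 _ (GA2_pullback_tofrac F q)) _.
by rewrite GA2_pullback_tofrac comp_mpolyA.
Qed.

Lemma GA2_pullbackK (K : fieldType) (F : GA2 K) :
  cancel (GA2_pullback F) (GA2_pullback F^-1%g).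
Proof.
move=> x; apply: etrans (esym (GA2_pullbackM F F^-1%g x)) _.
by rewrite mulgV GA2_pullback1.
Qed.

Lemma GA2_pullback_Kautomorphism (K : fieldType) (F : GA2 K) :
  is_Kautomorphism (GA2_pullback F).
Proof.
split; [exact: raddfB | by split; [exact: rmorph1 | exact: rmorphM] | |].
- by move=> c; rewrite GA2_pullback_tofrac comp_mpolyC.
exists (GA2_pullback F^-1%g); first exact: GA2_pullbackK.
by rewrite -{2}[F]invgK; apply: GA2_pullbackK.
Qed.

(** The inverse compensates for the contravariance seen in [GA2_pullbackM]. *)
Definition GA2_to_Cr2 (K : fieldType) (F : GA2 K) : Cr2 K :=
  MkCr2 (asboolT (GA2_pullback_Kautomorphism F^-1%g)).

Lemma GA2_to_Cr2P (K : fieldType) : is_GA2_inclusion (@GA2_to_Cr2 K).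
Proof.
have coordE (F : GA2 K) (i : 'I_2) :
    GA2_to_Cr2 F (tofrac 'X_i) = tofrac (tnth (F^-1)%g i).
  by apply: etrans (GA2_pullback_tofrac _ _) _; rewrite comp_mpolyXU -tnth_nth.
split=> [F G | F G FG |]; last exact: coordE.
  apply: val_inj; apply/funext => x.
  by apply: etrans (GA2_pullbackM _ _ x); rewrite -invgM.
apply: invg_inj; apply: val_inj; apply: eq_from_tnth => i.
by apply/eqP; rewrite -tofrac_eq -!coordE FG.
Qed.

(** * Witt translations *)

(** Applied over [K[X_1, X_2]], where a composite of translations is a Witt sum
    of three terms with polynomial entries. *)
Lemma witt_addA (p : nat) (p_pr : prime p) (R : comNzRingType) :
  associative (@witt_add R p).
Proof.
move=> [x0 x1] [y0 y1] [z0 z1]; congr (_, _) => /=; first exact: addrA.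
have /(canRL (addKr _)) -> := witt_cocycleP p_pr x0 y0 z0.
by ring.
Qed.

Lemma rmorph_witt_add (p : nat) (R S : comNzRingType) (f : {rmorphism R -> S})
    (x y : R * R) :
  (f (witt_add p x y).1, f (witt_add p x y).2) =
  witt_add p (f x.1, f x.2) (f y.1, f y.2).
Proof.
by rewrite /witt_add /= rmorphB !rmorphD rmorph_witt_cocycle.
Qed.

Section Translation.
Variables (K : fieldType) (p : nat) (charKp : p \in [pchar K]).
Implicit Types a b : W2 charKp.

Lemma W2_translationE a (i : 'I_2) :
  let F := witt_add p ('X_ord0, 'X_ord_max) (a.1%:MP, a.2%:MP) in
  tnth (W2_translation a) i = if i == ord0 then F.1 else F.2.
Proof. by rewrite (tnth_nth 0); case: i => [[|[|]]]. Qed.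

Lemma W2_translation0 : W2_translation (0 : W2 charKp) = polymap_id K.
Proof.
apply: eq_from_tnth => i; rewrite W2_translationE tnth_mktuple /=.
rewrite !mpolyC0 !addr0 (witt_cocycleC (pcharf_prime charKp)).
rewrite witt_cocycle0 subr0.
by case: eqP => [-> // | /eqP]; case: i => [[|[|]]].
Qed.

(** Substitution of the translation by [b] is a ring morphism fixing constants,
    so it replaces [X] by [X + b] in [X + a]; reassociating gives
    [X + (b + a)]. *)
Lemma W2_translationD a b :
  W2_translation (a + b) = polymap_comp (W2_translation a) (W2_translation b).
Proof.
have p_pr := pcharf_prime charKp.
pose f : {rmorphism {mpoly K[2]} -> {mpoly K[2]}} :=
  comp_mpoly (W2_translation b).
pose C2 (u : K * K) : {mpoly K[2]} * {mpoly K[2]} := (u.1%:MP, u.2%:MP).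
pose X : {mpoly K[2]} * {mpoly K[2]} := ('X_ord0, 'X_ord_max).
have addE : witt_add p X (C2 (a + b)) =
    (f (witt_add p X (C2 a)).1, f (witt_add p X (C2 a)).2).
  have fX : (f 'X_ord0, f 'X_ord_max) = witt_add p X (C2 b).
    by rewrite /f /= !comp_mpolyXU -!tnth_nth !W2_translationE.
  have fC : (f (C2 a).1, f (C2 a).2) = C2 a by rewrite /f /= !comp_mpolyC.
  rewrite rmorph_witt_add fX fC -(witt_addA p_pr); congr witt_add.
  by rewrite (addrC a b); exact: (rmorph_witt_add p (@mpolyC 2 K) b a).
have [add0 add1] := addE.
apply: eq_from_tnth => i; rewrite (W2_translationE (a + b) i).
rewrite [RHS]tnth_mktuple (W2_translationE a i).
by case: (i == ord0); [exact: add0 | exact: add1].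
Qed.

Fact W2_translation_invertible a :
  `[< exists G, polymap_inverse (W2_translation a) G >].
Proof.
apply/asboolP; exists (W2_translation (- a)).
by split; rewrite -W2_translationD ?subrr ?addNr W2_translation0.
Qed.

Definition W2_to_GA2 a : GA2 K := MkGA2 (W2_translation_invertible a).

Lemma W2_to_GA2_inj : injective W2_to_GA2.
Proof.
move=> [a0 a1] [b0 b1] /(congr1 (@GA2_map K)) eq_ab.
have coord0 : 'X_ord0 + a0%:MP = 'X_ord0 + b0%:MP :> {mpoly K[2]} :=
  congr1 (fun F : polymap K => F`_0) eq_ab.
have coord1 : 'X_ord_max + a1%:MP - witt_cocycle p 'X_ord0 a0%:MP =
    'X_ord_max + b1%:MP - witt_cocycle p 'X_ord0 b0%:MP :> {mpoly K[2]} :=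
  congr1 (fun F : polymap K => F`_1) eq_ab.
have mpolyC_inj : injective (@mpolyC 2 K).
  by move=> c d /eqP; rewrite mpolyC_eq => /eqP.
have eq0 : a0 = b0 := mpolyC_inj _ _ (addrI _ coord0).
rewrite eq0 in coord1 *.
by rewrite (mpolyC_inj _ _ (addrI _ (addIr _ coord1))).
Qed.

End Translation.

(** * Orders of Witt vectors *)

Lemma witt_cocycle_homog (R : comNzRingType) (p : nat) (c x y : R) :
  witt_cocycle p (x * c) (y * c) = witt_cocycle p x y * c ^+ p.
Proof.
rewrite /witt_cocycle mulr_suml; apply: eq_big_nat => i /andP[_ /ltnW le_ip].
by rewrite !exprMn mulrACA -exprD subnKC // -[RHS]mulrA.
Qed.

(** After multiplication by [p] the sum of [(k + 1) ^ p - k ^ p - 1] telescopes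
    to [p ^ p - p]; over the integers [p] can then be cancelled, which
    characteristic [p] does not allow. *)
Lemma sum_witt_cocycle_int (p : nat) : prime p ->
  \sum_(k < p) witt_cocycle p (k%:R : int) 1 = p%:R ^+ p.-1 - 1.
Proof.
move=> p_pr; have p_gt0 := prime_gt0 p_pr.
have p_neq0 : p%:R != 0 :> int by rewrite Num.Theory.pnatr_eq0 -lt0n.
apply: (mulfI p_neq0); rewrite mulr_sumr mulrBr mulr1 -exprS prednK //.
under eq_bigr do rewrite witt_cocycle_expD // natr1 expr1n.
rewrite sumrB big_const_ord iter_addr_0.
rewrite -(big_mkord xpredT (fun k => k.+1%:R ^+ p - k%:R ^+ p : int)).
by rewrite telescope_sumr // expr0n eqn0Ngt p_gt0 subr0.
Qed.

(** By homogeneity the sum is an integer times [c ^+ p]; that integer is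
    [p ^ (p - 1) - 1], and [p - 1 > 0] makes the power vanish in [K]. *)
Lemma sum_witt_cocycle_pchar (K : fieldType) (p : nat) (c : K) :
  p \in [pchar K] -> \sum_(k < p) witt_cocycle p (c *+ k) c = - c ^+ p.
Proof.
move=> charKp; have p_pr := pcharf_prime charKp.
have -> : \sum_(k < p) witt_cocycle p (c *+ k) c =
    (\sum_(k < p) witt_cocycle p (k%:R : int) 1)%:~R * c ^+ p.
  rewrite rmorph_sum mulr_suml; apply: eq_bigr => k _ /=.
  rewrite (rmorph_witt_cocycle p (@intmul K 1)) -witt_cocycle_homog.
  by rewrite rmorph1 mul1r rmorph_nat mulr_natl.
rewrite sum_witt_cocycle_int // rmorphB rmorph1 rmorphXn rmorph_nat /=.
by rewrite (pcharf0 charKp) expr0n -subn1 subn_eq0 leqNgt prime_gt1 // sub0r mulN1r.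
Qed.

Section W2Order.
Variables (K : fieldType) (p : nat) (charKp : p \in [pchar K]).
Implicit Types a : W2 charKp.

Lemma W2_mulrn a n :
  a *+ n = (a.1 *+ n, a.2 *+ n - \sum_(k < n) witt_cocycle p (a.1 *+ k) a.1).
Proof.
elim: n => [|n IHn]; first by rewrite big_ord0 subr0.
rewrite mulrSr IHn big_ord_recr; congr (_, _); first by rewrite /= mulrSr.
by rewrite /= mulrSr; ring.
Qed.

(** The map [a |-> a *+ p] is Verschiebung after Frobenius; that it kills only
    the vectors with zero first coordinate is what produces order [p ^ 2]. *)
Lemma W2_mulrp a : a *+ p = (0, a.1 ^+ p).
Proof.
rewrite W2_mulrn sum_witt_cocycle_pchar // opprK.
by rewrite !(mulrn_pchar charKp) add0r.
Qed.

Lemma W2_mulrn_fst0 a n : a.1 = 0 -> a *+ n = (0, a.2 *+ n).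
Proof.
move=> a0; rewrite W2_mulrn a0 mul0rn big1 ?subr0 // => k _.
by rewrite mul0rn witt_cocycle0.
Qed.

Lemma mulrn_eq0_pchar (c : K) m : c != 0 -> c *+ m = 0 -> (p %| m)%N.
Proof.
move=> c_neq0 /eqP; rewrite -mulr_natr mulf_eq0 (negPf c_neq0) /=.
by rewrite (dvdn_pcharf charKp).
Qed.

Lemma W2_order_fst0 a : a != 0 -> a.1 = 0 -> has_additive_order a p.
Proof.
move=> a_neq0 a1_0; have p_gt0 := prime_gt0 (pcharf_prime charKp).
have a2_neq0 : a.2 != 0.
  apply: contraNneq a_neq0 => a2_0.
  by rewrite [a]surjective_pairing a1_0 a2_0.
split=> // [|m /andP[m_gt0 lt_mp]].
  by rewrite W2_mulrp a1_0 expr0n eqn0Ngt p_gt0.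
rewrite W2_mulrn_fst0 // => -[/(mulrn_eq0_pchar a2_neq0)].
by move/(dvdn_leq m_gt0); rewrite leqNgt lt_mp.
Qed.

(** The first coordinate forces [p] to divide any annihilator [m] of [a], and
    [m %/ p] then annihilates the vector [a *+ p], which has order [p]. *)
Lemma W2_order_fst_neq0 a : a.1 != 0 -> has_additive_order a (p ^ 2).
Proof.
move=> a1_neq0; have [||p_gt0 pa_p pa_min] := @W2_order_fst0 (a *+ p).
- by apply/eqP; rewrite W2_mulrp => -[/eqP]; rewrite expf_eq0 (negPf a1_neq0) andbF.
- by rewrite W2_mulrp.
split=> [||m /andP[m_gt0 lt_m]]; first by rewrite expn_gt0 p_gt0.
  by rewrite -mulnn mulrnA.
move=> am_0; have /dvdnP[k def_m] : (p %| m)%N.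
  by apply: (mulrn_eq0_pchar a1_neq0); have := am_0; rewrite W2_mulrn => -[].
apply: (pa_min k); last by rewrite -mulrnA mulnC -def_m.
by move: m_gt0 lt_m; rewrite def_m -mulnn muln_gt0 ltn_pmul2r // => /andP[-> _].
Qed.

End W2Order.

Theorem proposition5p2 (K : fieldType) (p : nat) (charKp : p \in [pchar K]) :
  (exists (tau : W2 charKp -> GA2 K) (iota : GA2 K -> Cr2 K),
     [/\ forall a : W2 charKp, GA2_map (tau a) = W2_translation a,
         {morph tau : a b / a + b >-> (a * b)%g},
         injective tau
       & is_GA2_inclusion iota])
  /\ (forall a : W2 charKp, a.1 != 0 -> has_additive_order a (p ^ 2))
  /\ (forall a : W2 charKp, a != 0 -> a.1 = 0 -> has_additive_order a p).
Proof.
split; last by split; [exact: W2_order_fst_neq0 | exact: W2_order_fst0].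
exists (@W2_to_GA2 K p charKp), (@GA2_to_Cr2 K); split.
- by move=> a.
- by move=> a b; apply: val_inj; exact: W2_translationD.
- exact: W2_to_GA2_inj.
- exact: GA2_to_Cr2P.
Qed.
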